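(* Let $\mathcal{B}=[0,1]^2$ and let $\mathbb{P}$ be the two-move rider with moves $(c,d)$ and $(c,-d)$, where $c,d$ are nonzero relatively prime integers. Let $\hat c=\min(|c|,|d|)$ and $\hat d=\max(|c|,|d|)$. Then the denominator of $(\mathcal{B}^q,\mathcal{A}_{\mathbb{P}}^q)$ is $1$ if $q=1$; $\hat d$ if $q=2$; $2\hat d$ if $3\le q\le\lceil \hat d/\hat c\rceil$; and $2\hat c\hat d$ if $q\ge\lceil \hat d/\hat c\rceil+1$.
   Context: For $\mathbf{z}=(\mathbf{z}_1,\dots,\mathbf{z}_q)\in\mathbb{R}^{2q}$ with $\mathbf{z}_i=(x_i,y_i)$, and moves $\mathbf{m}_r=(c_r,d_r)$, attack equations are the hyperplanes $(\mathbf{z}_i-\mathbf{z}_j)\cdot(d_r,-c_r)=0$ for $i\ne j$, $r\in\{1,2\}$, forming $\mathcal{A}_{\mathbb{P}}^q$; fixations are the hyperplanes $x_i=0$, $x_i=1$, $y_i=0$, $y_i=1$. A vertex of $(\mathcal{B}^q,\mathcal{A}_{\mathbb{P}}^q)$ is a point of $[0,1]^{2q}$ that is the unique common point of some collection of attack equations and fixations. The denominator of a rational point is the lcm of the denominators of its coordinates; the denominator of the inside-out polytope is the lcm of the denominators of its vertices.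
   Formalization: The last case is stated for q ≥ 3 only: when |c| = |d| = 1 and q = 2 it overlaps the case q = 2 and would give 2, whereas the denominator is d̂ = 1; no other instance is affected. *)

(* Defs.v *)
From mathcomp Require Import all_boot all_order all_algebra.
From mathcomp Require Import classical_sets reals.

Set Implicit Arguments.
Unset Strict Implicit.
Unset Printing Implicit Defensive.

Import Order.TTheory GRing.Theory Num.Theory.
Local Open Scope classical_set_scope.
Local Open Scope ring_scope.

(* A configuration z = (z_1, ..., z_q) of R^(2q) is a q x 2 matrix whose row i
   is z_i = (x_i, y_i), i.e. x_i = z i 0 and y_i = z i 1. *)

Definition attack_hyperplane (R : realType) (q : nat) (m : int * int)
    (i j : 'I_q) : set 'M[R]_(q, 2) :=
  [set z | (z i 0 - z j 0) * m.2%:~R + (z i 1 - z j 1) * - m.1%:~R = 0].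

Definition attack_arrangement (R : realType) (q : nat)
    (moves : seq (int * int)) : set (set 'M[R]_(q, 2)) :=
  [set H | exists (m : int * int) (i j : 'I_q),
     [/\ m \in moves, i != j & H = @attack_hyperplane R q m i j]].

Definition fixations (R : realType) (q : nat) : set (set 'M[R]_(q, 2)) :=
  [set H | exists (i : 'I_q) (k : 'I_2) (b : bool),
     H = [set z : 'M[R]_(q, 2) | z i k = b%:R]].

Definition cube (R : realType) (q : nat) : set 'M[R]_(q, 2) :=
  [set z | forall i k, 0 <= z i k <= 1].

Definition is_vertex (R : realType) (q : nat) (moves : seq (int * int))
    (z : 'M[R]_(q, 2)) : Prop :=
  cube z /\
  exists2 C : set (set 'M[R]_(q, 2)),
    C `<=` @attack_arrangement R q moves `|` @fixations R q &
    \bigcap_(H in C) H = [set z].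

Definition point_denominator (q : nat) (w : 'M[rat]_(q, 2)) : nat :=
  \big[lcmn/1%N]_(i < q) \big[lcmn/1%N]_(k < 2) `|denq (w i k)|%N.

Definition is_lcm (S : set nat) (n : nat) : Prop :=
  (forall m, S m -> (m %| n)%N) /\
  (forall n', (forall m, S m -> (m %| n')%N) -> (n %| n')%N).

(* The first conjunct says that every vertex is a rational point, so that the
   lcm in the second one does range over all vertices. *)
Definition is_denominator (R : realType) (q : nat) (moves : seq (int * int))
    (D : nat) : Prop :=
  (forall z : 'M[R]_(q, 2), is_vertex moves z ->
     exists w : 'M[rat]_(q, 2), z = map_mx ratr w) /\
  is_lcm [set n | exists2 w : 'M[rat]_(q, 2),
            is_vertex moves (map_mx (@ratr R) w) & n = point_denominator w] D.

(* Main.v *)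
Require Import Defs.
From mathcomp Require Import all_boot all_order all_algebra.
From mathcomp Require Import classical_sets reals.
From mathcomp Require Import zify ring lra.

Import Order.TTheory GRing.Theory Num.Theory.
Local Open Scope ring_scope.

(* Along the lines of the two moves a piece has coordinates f = d x - c y and
   g = d x + c y; attacks equate two f's or two g's, and a fixation reads
   f + g = 2 d b or g - f = 2 c b with b in {0, 1}. A vertex is the only solution
   of all the equations it satisfies, so any map of the f's and g's preserving
   these equations fixes it. The odd map v |-> floor(v/2) + ceil(v/2) commutes
   with translation by even integers, so all f's and g's are integers and
   2 c d x, 2 c d y are integers. If (q - 1) c < d with c <= d, no chain of attacks
   joins x = 0 to x = 1; the same map rescaled by c, centred at 0 or at d on each
   attack component, shows that c divides g - f, so 2 d suffices. The bounds are
   reached by the crossing of the lines from two corners (for 2 d), and by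
   a zigzag from one side of the square meeting a line from the other side
   (for 2 c d). *)

(** * Vertices and denominators in coordinates *)

(** Constant along the move [(c, d)] for [e = false] and along [(c, -d)] for [e = true], so an
    attack is an equality of two values. *)
Definition line {R : realType} {q : nat} (c d : R) (e : bool)
    (x y : 'I_q -> R) (i : 'I_q) : R :=
  d * x i - (-1) ^+ e * c * y i.

(** No collection of hyperplanes is chosen: if some collection pins the point, so does the
    collection of all equations holding there. *)
Definition vertex {R : realType} {q : nat} (c d : R) (x y : 'I_q -> R) : Prop :=
  [/\ forall i, 0 <= x i <= 1, forall i, 0 <= y i <= 1 &
      forall x' y' : 'I_q -> R,
        (forall e i j, line c d e x y i = line c d e x y j ->
           line c d e x' y' i = line c d e x' y' j) ->
        (forall i (b : bool), x i = b%:R -> x' i = b%:R) ->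
        (forall i (b : bool), y i = b%:R -> y' i = b%:R) ->
        x' =1 x /\ y' =1 y].

(** Integrality over the reals is used so that rationality of the vertices follows from it instead
    of being presupposed. *)
Definition common_denominator {R : realType} (q : nat) (c d : R) (n : nat) : Prop :=
  forall x y : 'I_q -> R, vertex c d x y ->
    forall i, x i * n%:R \is a Num.int /\ y i * n%:R \is a Num.int.

Definition least_denominator {R : realType} (q : nat) (c d : R) (D : nat) : Prop :=
  common_denominator q c d D /\
  forall n, common_denominator q c d n -> (D %| n)%N.

(** Reflection in the diagonal multiplies each line form by a sign. This is what later allows
    assuming [c <= d]. *)
Lemma vertex_swap (R : realType) (q : nat) (c d : R) (x y : 'I_q -> R) :
  vertex c d x y -> vertex d c y x.
Proof.
have swap (e : bool) (u v : 'I_q -> R) i :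
    line d c e v u i = - (-1) ^+ e * line c d e u v i.
  by rewrite /line; case: e; rewrite ?expr0 ?expr1; ring.
case=> hx hy uniq; split=> // y' x' hl fy fx.
have [|//|//|//] := uniq x' y'.
move=> e i j eq_ij; have := hl e i j; rewrite !swap eq_ij => /(_ erefl).
by apply: mulfI; rewrite oppr_eq0 signr_eq0.
Qed.

Lemma least_denominator_swap (R : realType) (q : nat) (c d : R) (D : nat) :
  least_denominator q c d D -> least_denominator q d c D.
Proof.
have swap n (a b : R) :
    common_denominator q a b n -> common_denominator q b a n.
  by move=> h x y /vertex_swap/h h' i; have [] := h' i.
by case=> hD lD; split=> [|n hn]; [exact: swap|apply/lD/swap].
Qed.

(** * Translation from hyperplane arrangements and rational matrices *)

(** Changing the sign of [c] or [d] exchanges the two attack directions, which the xor with the sign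
    bits [bc] and [bd] records; the pair of moves is unaffected. *)
Lemma is_vertexE (R : realType) (q : nat) (c d : int) (z : 'M[R]_(q, 2)) :
  is_vertex [:: (c, d); (c, - d)] z <->
  vertex `|c|%N%:R `|d|%N%:R (z^~ 0) (z^~ 1).
Proof.
have absE (a : int) : exists b : bool, (a%:~R : R) = (-1) ^+ b * `|a|%N%:R.
  exists (a < 0); rewrite [in LHS](intEsign a) rmorphM /= rmorph_sign.
  by rewrite -pmulrn.
have [bc Ec] := absE c; have [bd Ed] := absE d.
have linesE e (w : 'M[R]_(q, 2)) i j :
    (line `|c|%N%:R `|d|%N%:R e (w^~ 0) (w^~ 1) i =
     line `|c|%N%:R `|d|%N%:R e (w^~ 0) (w^~ 1) j) <->
    attack_hyperplane (c, if e (+) bc (+) bd then - d else d) i j w.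
  rewrite /attack_hyperplane /line /=.
  by case: e bc bd Ec Ed => [] [] [] Ec Ed /=; rewrite ?rmorphN /= Ec Ed
    ?expr0 ?expr1; split=> h; lra.
have lineT m : m \in [:: (c, d); (c, - d)] ->
    exists e, m = (c, if e (+) bc (+) bd then - d else d).
  rewrite !inE => /orP[] /eqP ->; [exists (bc (+) bd)|exists (~~ (bc (+) bd))];
  by case: bc bd {Ec Ed linesE} => [] [].
split=> [[hz [C CA CE]]|[hx hy uniq]].
  split=> [i|i|x' y' hl fx fy]; [exact: hz|exact: hz|].
  pose w := \matrix_(i < q, k < 2) (if k == 0 then x' i else y' i) : 'M[R]_(q, 2).
  have wx i : w i 0 = x' i by rewrite mxE.
  have wy i : w i 1 = y' i by rewrite mxE.
  have zC : (\bigcap_(H in C) H)%classic z by rewrite CE.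
  have : (\bigcap_(H in C) H)%classic w.
    move=> H CH; have zH := zC H CH.
    case: (CA H CH) => [[m [i [j [/lineT[e ->] _ EH]]]]|[i [k [b EH]]]].
      rewrite EH in zH *; apply/linesE; have /linesE/hl := zH.
      by rewrite /line !wx !wy.
    rewrite EH /= in zH *; case: k zH {EH} => [[|[|//]] kp] zH.
      rewrite (_ : Ordinal kp = 0) ?wx; last exact/val_inj.
      by apply: fx; rewrite -zH; congr (z i _); apply/val_inj.
    rewrite (_ : Ordinal kp = 1) ?wy; last exact/val_inj.
    by apply: fy; rewrite -zH; congr (z i _); apply/val_inj.
  by rewrite CE /= => Ew; split=> i; rewrite -?wx -?wy Ew.
split=> [i k|].
  case: k => [[|[|//]] kp].
    by rewrite (_ : Ordinal kp = 0) //; apply/val_inj.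
  by rewrite (_ : Ordinal kp = 1) //; apply/val_inj.
(* The witness is the largest possible collection: all equations satisfied by [z]. *)
exists [set H | (attack_arrangement [:: (c, d); (c, - d)] H \/ fixations H)
  /\ H z]%classic => [H []//|].
apply/seteqP; split=> [w hw|_ -> H []//].
have [|i b zb|i b zb|Ex Ey] := uniq (w^~ 0) (w^~ 1).
- move=> e i j /linesE zij; apply/linesE.
  have [-> | nij] := eqVneq i j; first by rewrite /attack_hyperplane /=; lra.
  apply: hw; split=> //; left; eexists _, i, j; split=> //.
  by rewrite !inE; case: ifP => _; rewrite eqxx ?orbT.
- by apply: (hw [set w | w i 0 = b%:R]%classic); split=> //; right; exists i, 0, b.
- by apply: (hw [set w | w i 1 = b%:R]%classic); split=> //; right; exists i, 1, b.
apply/matrixP => i [[|[|//]] kp].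
  by rewrite (_ : Ordinal kp = 0) //; apply/val_inj.
by rewrite (_ : Ordinal kp = 1) //; apply/val_inj.
Qed.

Lemma denq_dvdP (R : realType) (a : rat) (n : nat) :
  reflect (ratr a * n%:R \is a (@Num.int R)) (`|denq a| %| n)%N.
Proof.
have da0 : (ratr (denq a)%:~R : R) != 0.
  by rewrite fmorph_eq0 intr_eq0 denq_neq0.
have aE : (ratr a : R) = (numq a)%:~R / (denq a)%:~R.
  by rewrite -[in LHS](divq_num_den a) fmorph_div /= !ratr_int.
rewrite ratr_int in da0.
apply: (iffP idP) => [/dvdnP[m ->]|/intrP[z Ez]].
  rewrite natrM [X in _ * (_ * X)](_ : _ = (denq a)%:~R); last first.
    by rewrite -[in RHS]absz_denq -pmulrn.
  rewrite aE; suff -> : (numq a)%:~R / (denq a)%:~R * (m%:R * (denq a)%:~R) =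
    (numq a * m%:Z)%:~R :> R by exact: intr_int.
  by rewrite rmorphM /= -pmulrn; field.
have : numq a * n%:Z = z * denq a.
  apply: (@intr_inj R); rewrite !rmorphM /= -Ez aE -pmulrn; field.
  exact: da0.
move/(congr1 absz); rewrite !abszM absz_nat => E.
rewrite -(@Gauss_dvdr _ `|numq a|); first by rewrite E dvdn_mull.
by rewrite coprime_sym coprime_num_den.
Qed.

Lemma point_denominator_dvdP (q : nat) (w : 'M[rat]_(q, 2)) (n : nat) :
  reflect (forall i k, `|denq (w i k)| %| n)%N (point_denominator w %| n)%N.
Proof.
have lcmP m (F : 'I_m -> nat) :
    (\big[lcmn/1%N]_(i < m) F i %| n)%N = [forall i, (F i %| n)%N].
  by rewrite (big_morph (fun a => (a %| n)%N) (fun a b => dvdn_lcm a b n) (dvd1n n))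
    big_andE.
rewrite /point_denominator lcmP; apply: (iffP forallP) => h i.
  by move=> k; have := h i; rewrite lcmP => /forallP.
by rewrite lcmP; apply/forallP.
Qed.

Lemma least_denominatorP (R : realType) (q : nat) (c d : int) (D : nat) :
  (0 < D)%N -> least_denominator q (`|c|%N%:R : R) `|d|%N%:R D ->
  is_denominator R q [:: (c, d); (c, - d)] D.
Proof.
move=> D0 [hD lD].
have vint n (z : 'M[R]_(q, 2)) : common_denominator q (`|c|%N%:R : R) `|d|%N%:R n ->
    is_vertex [:: (c, d); (c, - d)] z -> forall i k, z i k * n%:R \is a Num.int.
  move=> hn /is_vertexE/hn hz i [[|[|//]] kp].
    by rewrite (_ : Ordinal kp = 0) ?(hz i).1 //; apply/val_inj.
  by rewrite (_ : Ordinal kp = 1) ?(hz i).2 //; apply/val_inj.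
have ratz (z : 'M[R]_(q, 2)) : is_vertex [:: (c, d); (c, - d)] z ->
    exists w : 'M[rat]_(q, 2), z = map_mx ratr w.
  move=> /(vint _ _ hD) hz.
  (* The entries of [z] times [D] are integers, so the floor is exact and dividing by [D] recovers
     [z]. *)
  exists (\matrix_(i, k) ((Num.floor (z i k * D%:R))%:~R / D%:R)).
  apply/matrixP => i k; rewrite !mxE fmorph_div /= ratr_int ratr_nat floorK //.
  by rewrite mulfK // pnatr_eq0 -lt0n.
split=> //; split=> [_ [w hw ->]|n hn].
  apply/point_denominator_dvdP => i k; apply/(denq_dvdP R).
  by have := vint _ _ hD hw i k; rewrite mxE.
apply: lD => x y xy i.
pose z := \matrix_(i < q, k < 2) (if k == 0 then x i else y i) : 'M[R]_(q, 2).
have zx j : z j 0 = x j by rewrite mxE.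
have zy j : z j 1 = y j by rewrite mxE.
have hz : is_vertex [:: (c, d); (c, - d)] z.
  apply/is_vertexE; case: xy => hx hy u.
  split=> [j|j|x' y' hl fx fy]; rewrite ?zx ?zy //.
  have [|j b jb|j b jb|Ex Ey] := u x' y'.
  - by move=> e i' j'; have := hl e i' j'; rewrite /line !zx !zy.
  - by apply: fx; rewrite zx.
  - by apply: fy; rewrite zy.
  by split=> j; rewrite ?zx ?zy.
have [w Ew] := ratz _ hz.
have wn k : z i k * n%:R \is a Num.int.
  rewrite Ew mxE; apply/denq_dvdP; move: i k; apply/point_denominator_dvdP.
  by apply: hn; exists w; rewrite -?Ew.
by rewrite -zx -zy.
Qed.

(** * Rigidity of vertices and integrality of the line values *)

Lemma lineF (R : realType) (q : nat) (c d : R) (x y : 'I_q -> R) i :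
  line c d false x y i = d * x i - c * y i.
Proof. by rewrite /line expr0 mul1r. Qed.

Lemma lineT (R : realType) (q : nat) (c d : R) (x y : 'I_q -> R) i :
  line c d true x y i = d * x i + c * y i.
Proof. by rewrite /line expr1 mulN1r mulNr opprK. Qed.

(** Solving for the coordinates turns [F] into a configuration. The three hypotheses on [F] say that
    it keeps the attacks, the fixations of x and those of y, so it must be the vertex itself. *)
Lemma vertex_line_unique (R : realType) (q : nat) (c d : R) (x y : 'I_q -> R)
    (F : bool -> 'I_q -> R) :
  0 < c -> 0 < d -> vertex c d x y ->
  (forall e i j, line c d e x y i = line c d e x y j -> F e i = F e j) ->
  (forall i (b : bool),
     line c d false x y i = 2 * d * b%:R - line c d true x y i ->
     F false i = 2 * d * b%:R - F true i) ->
  (forall i (b : bool),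
     line c d true x y i = line c d false x y i + 2 * c * b%:R ->
     F true i = F false i + 2 * c * b%:R) ->
  forall e i, F e i = line c d e x y i.
Proof.
move=> c0 d0 [_ _ uniq] hF hx hy.
have cn0 : c != 0 by rewrite gt_eqF.
have dn0 : d != 0 by rewrite gt_eqF.
pose x' i := (F true i + F false i) / (2 * d).
pose y' i := (F true i - F false i) / (2 * c).
have FE e i : line c d e x' y' i = F e i.
  by case: e; rewrite ?lineF ?lineT /x' /y'; field; rewrite ?cn0 ?dn0.
have [e i j /hF|i b xb|i b yb|Ex Ey e i] := uniq x' y'; first by rewrite !FE.
- rewrite /x' (hx i b); first by field.
  by rewrite lineF lineT xb; ring.
- rewrite /y' (hy i b); first by field.
  by rewrite lineF lineT yb; ring.
by rewrite -FE /line Ex Ey.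
Qed.

(* An odd map commuting with translation by [2 * s], whose fixed points are
   the multiples of [s]. *)
Definition snap {R : realType} (s v : R) : R :=
  s * ((Num.floor (v / (2 * s)))%:~R + (Num.ceil (v / (2 * s)))%:~R).

Lemma snapN (R : realType) (s v : R) : snap s (- v) = - snap s v.
Proof.
rewrite /snap mulNr (floorNceil (- _)) opprK (ceilNfloor (- _)) opprK !mulrNz; ring.
Qed.

Lemma snapD (R : realType) (s v : R) (n : nat) :
  0 < s -> snap s (v + 2 * s * n%:R) = snap s v + 2 * s * n%:R.
Proof.
move=> s0; have sn0 : s != 0 by rewrite gt_eqF.
rewrite /snap (_ : (v + 2 * s * n%:R) / (2 * s) = v / (2 * s) + n%:R); last by field.
have nint : (n%:R : R) \is a Num.int by rewrite natr_int.
by rewrite floorDrz ?ceilDrz // !rmorphD /= (floorK nint) (ceilK nint); ring.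
Qed.

Lemma snap_int (R : realType) (s v : R) : 0 < s -> snap s v / s \is a Num.int.
Proof.
by move=> s0; rewrite /snap mulrC mulKf ?gt_eqF // -rmorphD /= intr_int.
Qed.

(** [snap 1] respects equalities, sign changes and shifts by [2 * d * b] and [2 * c * b], which are
    even integers; by rigidity it fixes every line value. *)
Lemma vertex_line_int (R : realType) (q c d : nat) (x y : 'I_q -> R) :
  (0 < c)%N -> (0 < d)%N -> vertex c%:R d%:R x y ->
  forall e i, line c%:R d%:R e x y i \is a Num.int.
Proof.
move=> c0 d0 xy e i.
have E := @vertex_line_unique _ _ c%:R d%:R x y
  (fun e i => snap 1 (line c%:R d%:R e x y i)).
rewrite -E ?ltr0n //.
- by rewrite -[snap _ _]divr1 snap_int.
- by move=> e' k l ->.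
- move=> k b ->; rewrite -(mulr1 2) -mulrA -natrM addrC snapD // snapN; ring.
- move=> k b ->; rewrite -(mulr1 2) -mulrA -natrM snapD //.
Qed.

(** * Upper bounds [2 * c * d] and [2 * d] *)

Lemma coord_line (R : realType) (q : nat) (c d : R) (x y : 'I_q -> R) i :
  2 * d * x i = line c d true x y i + line c d false x y i /\
  2 * c * y i = line c d true x y i - line c d false x y i.
Proof. by rewrite lineF lineT; split; ring. Qed.

Lemma common_denominator_all (R : realType) (q c d : nat) :
  (0 < c)%N -> (0 < d)%N ->
  common_denominator q (c%:R : R) d%:R (2 * c * d).
Proof.
move=> c0 d0 x y xy i; have [Ex Ey] := @coord_line _ _ c%:R d%:R x y i.
have hi := @vertex_line_int _ _ _ _ _ _ c0 d0 xy ^~ i.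
split.
  rewrite (_ : _ * _ = c%:R * (2 * d%:R * x i)); last by rewrite !natrM; ring.
  by rewrite Ex rpredM ?natr_int // rpredD.
rewrite (_ : _ * _ = d%:R * (2 * c%:R * y i)); last by rewrite !natrM; ring.
by rewrite Ey rpredM ?natr_int // rpredB.
Qed.

(* Each attack moves the abscissa by at most [c / d], since ordinates lie in [0, 1]. *)
Lemma attack_path_dist (R : realType) (q : nat) (c d : R) (x y : 'I_q -> R) i p :
  0 < c -> 0 < d -> (forall i, 0 <= y i <= 1) ->
  path (fun i j => [exists e, line c d e x y i == line c d e x y j]) i p ->
  d * `|x (last i p) - x i| <= c * (size p)%:R.
Proof.
move=> c0 d0 hy; elim: p i => [|j p IH] i /=; first by rewrite subrr normr0 !mulr0.
case/andP=> /existsP[e /eqP eij] /IH h.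
have hij : d * `|x j - x i| <= c.
  have /andP[y0 y1] := hy i; have /andP[y0' y1'] := hy j.
  rewrite -(gtr0_norm d0) -normrM ler_norml.
  by move: eij; case: e; rewrite ?lineT ?lineF => eij; apply/andP; split; nra.
have := ler_normD (x (last j p) - x j) (x j - x i).
rewrite addrA subrK -(ler_pM2l d0) mulrDr => h'.
by rewrite -natr1 mulrDr mulr1; lra.
Qed.

(* With few pieces no chain of attacks joins the edge [x = 0] to [x = 1], so on
   each attack component the lines can be snapped modulo [c] rather than 1. *)
Lemma vertex_lines_congr (R : realType) (q c d : nat) (x y : 'I_q -> R) :
  (0 < c)%N -> (0 < d)%N -> (q.-1 * c < d)%N -> vertex c%:R d%:R x y ->
  forall i, (line c%:R d%:R true x y i - line c%:R d%:R false x y i) / c%:R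
    \is a Num.int.
Proof.
move=> c0 d0 qcd xy; have [_ hy _] := xy.
have C0 : 0 < c%:R :> R by rewrite ltr0n.
have D0 : 0 < d%:R :> R by rewrite ltr0n.
pose att (i j : 'I_q) := [exists e, line c%:R d%:R e x y i == line c%:R d%:R e x y j].
have att_sym : connect_sym att.
  apply: sym_connect_sym => i j; rewrite /att.
  by apply: eq_existsb => e; rewrite eq_sym.
(* A path without repetition has at most [q.-1] attacks, so x varies by at most
   [q.-1 * c / d < 1]. *)
have far i j : connect att i j -> x i = 1 -> x j = 0 -> False.
  move=> /connectP[p pp ->] xi xj; case/shortenP: pp xj => p' pp' up _ xj.
  have := @attack_path_dist _ _ _ _ _ _ _ _ C0 D0 hy pp'.
  rewrite xi xj sub0r normrN1 mulr1 -natrM ler_nat => dle.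
  have : (size (i :: p') <= q)%N by rewrite -(card_uniqP up) -[leqRHS]card_ord max_card.
  by move=> /= sq; nia.
pose left i := [exists j, connect att i j && (x j == 0)].
have left_att i j : att i j -> left i = left j.
  move=> ij; apply: eq_existsb => k; congr (_ && _).
  by apply: (same_connect att_sym); apply: connect1.
(* The fixation x = 0 reflects line values about 0 and x = 1 reflects them about [d]. By [far] a
   component meets at most one of these edges, so one centre per component suffices; it cancels in
   the difference of the two lines. *)
pose F e i := let v := line c%:R d%:R e x y i in
  if left i then snap c%:R v else d%:R + snap c%:R (v - d%:R).
have FE : forall e i, F e i = line c%:R d%:R e x y i.
  apply: (@vertex_line_unique _ _ _ _ _ _ F C0 D0 xy) => // [e i j eij|i b xb|i b yb]; rewrite /F.
  - rewrite eij (left_att i j) //; apply/existsP; exists e; exact/eqP.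
  - have xE : x i = b%:R.
      have [/esym/eqP + _] := @coord_line _ _ c%:R d%:R x y i.
      rewrite xb addrC subrK => /eqP /(mulfI _) -> //.
      by rewrite mulf_neq0 ?pnatr_eq0 // -lt0n.
    case: (boolP (left i)) => [/existsP[j /andP[ij /eqP xj]]|nl].
      case: b xb xE => xb xE; first by case: (far i j).
      by rewrite xb mulr0 !sub0r snapN.
    case: b xb xE => xb xE; last first.
      by case/existsP: nl; exists i; rewrite connect0 xE eqxx.
    rewrite xb mulr1 (_ : 2 * d%:R - _ - d%:R = - (line c%:R d%:R true x y i - d%:R)).
      by rewrite snapN; ring.
    by ring.
  case: ifP => _; rewrite yb; first by rewrite snapD.
  by rewrite addrAC snapD //; ring.
move=> i; rewrite -!FE /F; case: ifP => _; first by rewrite mulrBl rpredB ?snap_int.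
by rewrite opprD addrACA subrr add0r mulrBl rpredB ?snap_int.
Qed.

Lemma common_denominator_few (R : realType) (q c d : nat) :
  (0 < c)%N -> (0 < d)%N -> (q.-1 * c < d)%N ->
  common_denominator q (c%:R : R) d%:R (2 * d).
Proof.
move=> c0 d0 qcd x y xy i; have [Ex Ey] := @coord_line _ _ c%:R d%:R x y i.
have hi := @vertex_line_int _ _ _ _ _ _ c0 d0 xy ^~ i.
have hc := @vertex_lines_congr _ _ _ _ _ _ c0 d0 qcd xy i.
split; first by rewrite natrM mulrC Ex rpredD.
rewrite (_ : _ * _ = d%:R * ((2 * c%:R * y i) / c%:R)).
  by rewrite Ey rpredM ?natr_int.
by rewrite !natrM; field; rewrite pnatr_eq0 -lt0n.
Qed.

(** * Upper bounds for one and two pieces *)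

(** When only coincident pieces attack, replacing every coordinate other than 1 by 0 preserves all
    equations, so uniqueness says that it changes nothing. *)
Lemma vertex_corner (R : realType) (q : nat) (c d : R) (x y : 'I_q -> R) :
  vertex c d x y ->
  (forall e i j, line c d e x y i = line c d e x y j -> x i = x j /\ y i = y j) ->
  forall i, x i = (x i == 1)%:R /\ y i = (y i == 1)%:R.
Proof.
case=> _ _ uniq h.
have [e i j /h[Ex Ey]|i b ->|i b ->|Ex Ey i] :=
  uniq (fun i => (x i == 1)%:R) (fun i => (y i == 1)%:R).
- by rewrite /line Ex Ey.
- by case: b; rewrite ?eqxx // eq_sym oner_eq0.
- by case: b; rewrite ?eqxx // eq_sym oner_eq0.
by split; [rewrite Ex|rewrite Ey].
Qed.

Lemma common_denominator1 (R : realType) (c d : R) :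
  common_denominator 1 c d 1.
Proof.
move=> x y xy i; rewrite !mulr1.
have [e k l _|-> ->] := vertex_corner _ _ _ _ _ _ xy _ i.
  by rewrite (ord1 k) (ord1 l).
by rewrite !natr_int.
Qed.

Lemma bitP (R : realType) (v : R) :
  reflect (exists b : bool, v = b%:R) ((v == 0) || (v == 1)).
Proof.
apply: (iffP orP) => [[]/eqP->|[[] ->]].
- by exists false.
- by exists true.
- by right.
- by left.
Qed.

(** Unless all attacks are between coincident pieces, exactly one attack equation links the two.
    Four unknowns then need three fixations: one piece is at a corner and the other on an edge. *)
Lemma common_denominator2 (R : realType) (c d : nat) :
  (0 < c)%N -> (c <= d)%N -> common_denominator 2 (c%:R : R) d%:R d.
Proof.
move=> c0 cd x y xy.
have C0 : 0 < c%:R :> R by rewrite ltr0n.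
have D0 : 0 < d%:R :> R by rewrite ltr0n (leq_trans c0).
have CD : c%:R <= d%:R :> R by rewrite ler_nat.
have cn0 : c%:R != 0 :> R by rewrite gt_eqF.
have dn0 : d%:R != 0 :> R by rewrite gt_eqF.
pose l e i := line c%:R d%:R e x y i.
case: (boolP [forall e, forall a, forall b,
    (l e a == l e b) ==> ((x a == x b) && (y a == y b))]) => [hcor i|].
  have [e a b lab|-> ->] := vertex_corner _ _ _ _ _ _ xy _ i.
    have /forallP/(_ e)/forallP/(_ a)/forallP/(_ b) := hcor.
    by move/eqP: lab; rewrite /l => -> /= /andP[/eqP-> /eqP->].
  by split; rewrite rpredM ?natr_int.
case/forallPn=> e /forallPn[a /forallPn[b]]; rewrite negb_imply => /andP[/eqP lab nab].
have neq_ab : a != b by apply: contraNneq nab => ->; rewrite !eqxx.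
have ab k : k = a \/ k = b.
  by case: a b k neq_ab {lab nab} => [[|[|//]] ?] [[|[|//]] ?] [[|[|//]] ?] //= _;
    (try by left; apply/val_inj); right; apply/val_inj.
(* Agreement of both line values would make the two pieces coincide. *)
have nlab : l (~~ e) a <> l (~~ e) b.
  move=> lab'; case/negP: nab; move: lab lab'; rewrite /l.
  by case: e; rewrite /= !lineT !lineF => h h'; apply/andP; split; apply/eqP;
    [apply: (mulfI dn0)|apply: (mulfI cn0)|apply: (mulfI dn0)|apply: (mulfI cn0)]; lra.
have [cubx cuby uniq] := xy.
have move_pieces x' y' : line c%:R d%:R e x' y' a = line c%:R d%:R e x' y' b ->
    forall e' i j, l e' i = l e' j -> line c%:R d%:R e' x' y' i = line c%:R d%:R e' x' y' j.
  move=> h e' i j lij; have [->//|neq_ij] := eqVneq i j.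
  have Ee : e' = e.
    apply/eqP; apply/negP => /negP ne; have Ee : e' = ~~ e.
      by case: (e) (e') ne => [] [].
    apply: nlab; rewrite -Ee.
    by case: (ab i) (ab j) neq_ij lij => -> [] ->; rewrite ?eqxx.
  by rewrite Ee; case: (ab i) (ab j) => -> [] ->.
pose P k := (x k == 0) || (x k == 1).
pose Q k := (y k == 0) || (y k == 1).
have sqr_e : (-1) ^+ e * (-1) ^+ e = 1 :> R by rewrite -expr2 sqrr_sign.
have [k Pk Qk] : exists2 k, P k & Q k.
  have [/existsP[k /andP[Pk Qk]]|/existsPn none] := boolP [exists k, P k && Q k].
    by exists k.
  (* If no piece is at a corner, each has a free coordinate; moving it raises both [e] line values
     by 1 and keeps the attack. *)
  pose x' k := if P k then x k else x k + d%:R^-1.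
  pose y' k := if P k then y k - (-1) ^+ e / c%:R else y k.
  have l' k : line c%:R d%:R e x' y' k = l e k + 1.
    rewrite /l /line /x' /y'; case: ifP => _; last by field.
    transitivity (l e k + (-1) ^+ e * (-1) ^+ e); rewrite /l /line; first by field.
    by rewrite sqr_e.
  have [|i v xv|i v yv|/(_ a) + /(_ a)] := uniq x' y'.
  - by apply: move_pieces; rewrite !l' lab.
  - by rewrite /x' ifT //; apply/bitP; exists v.
  - rewrite /y' ifF //; apply: contraNF (none i) => ->.
    by apply/bitP; exists v.
  rewrite /x' /y'; case: ifP => _.
    move=> _ /eqP; rewrite -subr_eq0 addrAC subrr add0r oppr_eq0.
    by rewrite mulf_eq0 signr_eq0 invr_eq0 (negPf cn0).
  by move/eqP; rewrite -subr_eq0 addrAC subrr add0r invr_eq0 (negPf dn0).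
have PQ j : j != k -> P j || Q j.
  move=> jk; apply/negP => /negP; rewrite negb_or => /andP[nP nQ].
  (* A piece on no edge can slide along its attack line. *)
  pose x' i := if i == j then x i + d%:R^-1 else x i.
  pose y' i := if i == j then y i + (-1) ^+ e / c%:R else y i.
  have l' i : line c%:R d%:R e x' y' i = l e i.
    rewrite /l /line /x' /y'; case: ifP => _ //.
    transitivity (l e i + 1 - (-1) ^+ e * (-1) ^+ e); rewrite /l /line.
      by field; rewrite cn0 dn0.
    by rewrite sqr_e addrK.
  have [|i v xv|i v yv|/(_ j) + _] := uniq x' y'.
  - by apply: move_pieces; rewrite !l' lab.
  - rewrite /x' ifF //; apply: contraNF nP => /eqP <-; by apply/bitP; exists v.
  - rewrite /y' ifF //; apply: contraNF nQ => /eqP <-; by apply/bitP; exists v.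
  rewrite /x' eqxx => /eqP; rewrite -subr_eq0 addrAC subrr add0r invr_eq0.
  by rewrite (negPf dn0).
have lk j : l e j = l e k by case: (ab j) (ab k) => -> [] ->.
case/bitP: (Pk) => b1 xk; case/bitP: (Qk) => b2 yk i.
have [->|neq_ik] := eqVneq i k; first by rewrite xk yk -!natrM !natr_int.
have /orP PQi := PQ i neq_ik.
have /bitP[b3 yi] : Q i.
  case: PQi => // /bitP[b0 xi].
  have /andP[y0 y1] := cuby i; move: (lk i); rewrite /l /line xi xk yk /Q.
  move: y0; rewrite le_eqVlt => /orP[/eqP <-|y0]; first by rewrite eqxx.
  move: y1; rewrite le_eqVlt => /orP[/eqP ->|y1]; first by rewrite eqxx orbT.
  have h0 := mulr_gt0 C0 y0.
  have h1 : 0 < c%:R * (1 - y i) by rewrite mulr_gt0 // subr_gt0.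
  by case: b0 b1 b2 e {xi xk yk Pk Qk l lab nlab lk move_pieces sqr_e neq_ik nab xy uniq PQ}
    => [] [] [] []; rewrite ?expr0 ?expr1 /=; lra.
split; last by rewrite yi -natrM natr_int.
have -> : x i * d%:R = d%:R * b1%:R + (-1) ^+ e * c%:R * (b3%:R - b2%:R).
  by have := lk i; rewrite /l /line xk yk yi; lra.
by rewrite rpredD ?rpredM ?rpredB ?natr_int ?rpredX ?rpredN ?rpred1.
Qed.

(** * Lower bounds from explicit vertices *)

Lemma frac_int_dvdn (R : realType) (a b n : nat) :
  (0 < b)%N -> a%:R / b%:R * n%:R \is a (@Num.int R) -> (b %| a * n)%N.
Proof.
move=> b0 /intrP[z Ez].
have bn0 : b%:R != 0 :> R by rewrite pnatr_eq0 -lt0n.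
have : (a * n)%N%:Z = z * b%:Z.
  apply: (@intr_inj R); rewrite intrM -Ez -!pmulrn natrM; field.
  exact: bn0.
move/(congr1 absz); rewrite abszM !absz_nat => ->.
exact: dvdn_mull.
Qed.

Lemma dvdn_common2 (R : realType) (q c d n : nat) :
  (0 < c)%N -> (c <= d)%N -> coprime c d -> (1 < q)%N ->
  common_denominator q (c%:R : R) d%:R n -> (d %| n)%N.
Proof.
move=> c0 cd cop q1 hn.
have D0 : 0 < d%:R :> R by rewrite ltr0n (leq_trans c0).
have dn0 : d%:R != 0 :> R by rewrite gt_eqF.
have CD : c%:R <= d%:R :> R by rewrite ler_nat.
(* Piece 1 is where the line from the corner (0, 0) meets y = 1; all other pieces stay at that
   corner. *)
pose x (i : 'I_q) : R := if i == 1%N :> nat then c%:R / d%:R else 0.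
pose y (i : 'I_q) : R := (i == 1%N :> nat)%:R.
pose i0 : 'I_q := Ordinal (ltnW q1); pose i1 : 'I_q := Ordinal q1.
have xy : vertex c%:R d%:R x y.
  split=> [i|i|x' y' hl fx fy].
  - rewrite /x; case: ifP => _; last by rewrite lexx ler01.
    by rewrite divr_ge0 ?ler0n //= ler_pdivrMr // mul1r.
  - by rewrite /y; case: eqP => _; rewrite lexx ler01.
  have y'E i : y' i = y i by exact: fy.
  split=> // i; have [i1E|ni1] := eqVneq (i : nat) 1%N; last first.
    by rewrite /x (negPf ni1); apply: (fx i false); rewrite /x (negPf ni1).
  have -> : i = i1 by exact/val_inj.
  have x0 : x' i0 = 0 by exact: (fx i0 false).
  have := hl false i1 i0; rewrite !lineF !y'E x0 /x /y /= => E.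
  apply: (mulfI dn0); have -> : d%:R * (c%:R / d%:R) = c%:R :> R by field.
  by have := E ltac:(by field); lra.
have [+ _] := hn _ _ xy i1; rewrite /x /= => /frac_int_dvdn.
by rewrite (leq_trans c0) // Gauss_dvdr 1?coprime_sym // => ->.
Qed.

Lemma dvdn_common3 (R : realType) (q c d n : nat) :
  (0 < c)%N -> (c <= d)%N -> coprime c d -> (2 < q)%N ->
  common_denominator q (c%:R : R) d%:R n -> (2 * d %| n)%N.
Proof.
move=> c0 cd cop q2 hn.
have d0 : (0 < d)%N by apply: leq_trans cd.
have C0 : 0 < c%:R :> R by rewrite ltr0n.
have D0 : 0 < d%:R :> R by rewrite ltr0n.
have cn0 : c%:R != 0 :> R by rewrite gt_eqF.
have dn0 : d%:R != 0 :> R by rewrite gt_eqF.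
have CD : c%:R <= d%:R :> R by rewrite ler_nat.
(* Piece 2 is the crossing of the lines from piece 0 at (0, 0) and piece 1 at (0, 1); spare pieces
   sit at (0, 0). *)
pose x (i : 'I_q) : R := if i == 2%N :> nat then c%:R / (2 * d)%N%:R else 0.
pose y (i : 'I_q) : R := if i == 2%N :> nat then 1%N%:R / 2%N%:R else (i == 1%N :> nat)%:R.
have q1 : (1 < q)%N by apply: ltnW.
pose i0 : 'I_q := Ordinal (ltnW q1); pose i1 : 'I_q := Ordinal q1.
pose i2 : 'I_q := Ordinal q2.
have xy : vertex c%:R d%:R x y.
  split=> [i|i|x' y' hl fx fy].
  - rewrite /x; case: ifP => _; last by rewrite lexx ler01.
    rewrite divr_ge0 ?ler0n //= ler_pdivrMr ?ltr0n ?muln_gt0 // mul1r ler_nat.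
    by lia.
  - rewrite /y; case: eqP => _; last by case: eqP => _; rewrite lexx ler01.
    by lra.
  have [i2E ni2] : (forall i, i != i2 -> x' i = x i) * (forall i, i != i2 -> y' i = y i).
    split=> i; rewrite -val_eqE /= => ni2.
      by rewrite /x (negPf ni2); apply: (fx i false); rewrite /x (negPf ni2).
    by rewrite /y (negPf ni2); apply: fy; rewrite /y (negPf ni2).
  have [Ex Ey] : x' i2 = x i2 /\ y' i2 = y i2.
    have := hl false i2 i0; have := hl true i2 i1.
    rewrite !lineT !lineF (i2E i0) // (i2E i1) // (ni2 i0) // (ni2 i1) // /x /y /=.
    rewrite natrM => E1 E2.
    have {}E1 := E1 ltac:(by field); have {}E2 := E2 ltac:(by field).
    split.
      apply: (mulfI dn0); rewrite (_ : _ * (_ / _) = c%:R / 2); last by field.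
      by lra.
    by apply: (mulfI cn0); lra.
  by split=> i; have [->//|ni] := eqVneq i i2; [apply: i2E|apply: ni2].
have [+ +] := hn _ _ xy i2; rewrite /x /y /=.
have dd0 : (0 < 2 * d)%N by rewrite muln_gt0.
(* The ordinate 1/2 makes [n] even; halving the condition from the abscissa leaves [d] dividing
   [c * m]. *)
move=> /(@frac_int_dvdn _ _ _ _ dd0) hd /(@frac_int_dvdn _ _ _ _ (ltn0Sn 1)).
rewrite mul1n => /dvdnP[m En]; move: hd; rewrite En [(m * 2)%N]mulnC mulnCA.
by rewrite !dvdn_pmul2l // Gauss_dvdr // coprime_sym.
Qed.

(* Pieces [0..m] bounce between the edges [y = 0] and [y = 1] starting from the
   corner (0, 0); piece [m + 1] sits at the corner (1, odd m), and piece [m + 2]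
   where the lines leaving pieces [m] and [m + 1] meet. *)
Lemma dvdn_common_zigzag (R : realType) (q c d m n : nat) :
  (0 < c)%N -> (0 < d)%N -> (m * c <= d <= (m + 2) * c)%N -> (m + 2 < q)%N ->
  common_denominator q (c%:R : R) d%:R n -> (2 * c %| (d - m * c) * n)%N.
Proof.
move=> c0 d0 /andP[mcd dmc] qm hn.
have C0 : 0 < c%:R :> R by rewrite ltr0n.
have D0 : 0 < d%:R :> R by rewrite ltr0n.
have cn0 : c%:R != 0 :> R by rewrite gt_eqF.
have dn0 : d%:R != 0 :> R by rewrite gt_eqF.
have MCD : m%:R * c%:R <= d%:R :> R by rewrite -natrM ler_nat.
have DMC : d%:R <= (m%:R + 2) * c%:R :> R by rewrite -natrD -natrM ler_nat.
(* Pieces [m] and [m + 1] lie on the same horizontal edge, so their lines meet midway between them,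
   at distance [h] from that edge. The bound [d <= (m + 2) * c] keeps [h] at most 1. *)
pose h : R := (d - m * c)%:R / (2 * c)%:R.
have hE : h = (d%:R - m%:R * c%:R) / (2 * c%:R) by rewrite /h natrB // !natrM.
have h0 : 0 <= h by rewrite divr_ge0 ?ler0n.
have h1 : h <= 1 by rewrite hE ler_pdivrMr; lra.
pose X (j : nat) : R := if (j <= m)%N then j%:R * c%:R / d%:R else
  if j == m.+1 then 1 else if j == m.+2 then (m%:R * c%:R / d%:R + 1) / 2 else 0.
pose Y (j : nat) : R := if (j <= m)%N then (odd j)%:R else
  if j == m.+1 then (odd m)%:R else if j == m.+2 then if odd m then 1 - h else h else 0.
pose x (i : 'I_q) := X i; pose y (i : 'I_q) := Y i.
have mcd1 (j : nat) : (j <= m)%N -> 0 <= (j%:R * c%:R / d%:R : R) <= 1.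
  move=> jm; rewrite divr_ge0 ?mulr_ge0 ?ler0n //= ler_pdivrMr // mul1r.
  by apply: le_trans MCD; rewrite ler_pM2r // ler_nat.
have q1 : (m.+1 < q)%N by lia.
have q2 : (m.+2 < q)%N by lia.
pose i1 : 'I_q := Ordinal q1; pose i2 : 'I_q := Ordinal q2.
have xy : vertex c%:R d%:R x y.
  split=> [i|i|x' y' hl fx fy].
  - rewrite /x /X; case: leqP => [/mcd1//|_]; case: eqP => _; first by rewrite ler01 lexx.
    case: eqP => _; last by rewrite ler01 lexx.
    by have := mcd1 m (leqnn m); lra.
  - rewrite /y /Y; case: leqP => _; first by case: odd; rewrite lexx ler01.
    case: eqP => _; first by case: odd; rewrite lexx ler01.
    case: eqP => _; last by rewrite lexx ler01.
    by case: odd; lra.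
  have Ey (i : 'I_q) : (i : nat) != m.+2 -> y' i = y i.
    rewrite /y /Y => ni2; move: (fy i); rewrite /y /Y.
    case: leqP => _; first exact.
    case: eqP => _; first exact.
    by rewrite (negPf ni2) => /(_ false) ->.
  have Ex0 (i : 'I_q) : (m < i)%N -> (i : nat) != m.+2 -> x' i = x i.
    rewrite /x /X => mi ni2; move: (fx i); rewrite /x /X leqNgt mi /=.
    by case: eqP => _; [move/(_ true) ->|rewrite (negPf ni2) => /(_ false) ->].
  (* Along the zigzag, the abscissa of each piece follows from the previous one: the ordinates are
     fixed and the attack directions alternate with parity. *)
  have Exm j (jq : (j < q)%N) : (j <= m)%N -> x' (Ordinal jq) = x (Ordinal jq).
    elim: j jq => [|j IH] jq jm.
      by rewrite /x /X /= !mul0r; apply: (fx _ false); rewrite /x /X /= !mul0r.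
    have jq' : (j < q)%N by apply: ltnW.
    have jm' : (j <= m)%N by apply: ltnW.
    have := hl (odd j) (Ordinal jq) (Ordinal jq').
    rewrite /line (IH jq') // !Ey /=; [|lia|lia].
    rewrite /x /y /X /Y /= jm jm' /= => E.
    apply: (mulfI dn0); apply: (addIr (- ((-1) ^+ odd j * c%:R * (~~ odd j)%:R))).
    by rewrite E //; case: odd; rewrite ?expr0 ?expr1 -natr1 /=; field.
  have Ex (i : 'I_q) : (i : nat) != m.+2 -> x' i = x i.
    by case: (leqP i m) => [|/Ex0//]; case: i => k kq /= km _; exact: Exm.
  have mq : (m < q)%N by lia.
  have [X2 Y2] : x' i2 = x i2 /\ y' i2 = y i2.
    have := hl (odd m) i2 (Ordinal mq); have := hl (~~ odd m) i2 i1.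
    rewrite /line (Ex i1) ?(Ex (Ordinal mq)) ?(Ey i1) ?(Ey (Ordinal mq)) /=; try lia.
    rewrite /x /y /X /Y /=.
    rewrite leqnn !eqxx !(leqNgt _ m) !ltnS !leqnn !leqnSn /= (gtn_eqF (ltnSn _)).
    rewrite hE => E1 E2.
    have {}E1 := E1 ltac:(by case: odd; rewrite ?expr0 ?expr1 /=; field; rewrite ?cn0 ?dn0).
    have {}E2 := E2 ltac:(by case: odd; rewrite ?expr0 ?expr1 /=; field; rewrite ?cn0 ?dn0).
    have dd : d%:R * (m%:R * c%:R / d%:R) = m%:R * c%:R :> R by field.
    rewrite dd in E2; split.
      apply: (mulfI dn0); rewrite mulrA mulrDr dd.
      by case: odd E1 E2; rewrite ?expr0 ?expr1 /= => E1 E2; lra.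
    apply: (mulfI cn0).
    transitivity ((if odd m then c%:R - (d%:R - m%:R * c%:R) / 2
      else (d%:R - m%:R * c%:R) / 2) : R); last by case: odd; field.
    by case: odd E1 E2; rewrite ?expr0 ?expr1 /= => E1 E2; lra.
  by split=> i; have [->//|] := eqVneq i i2; rewrite -val_eqE /=; [apply: Ex|apply: Ey].
have [_ +] := hn _ _ xy i2.
rewrite /y /Y /= !(leqNgt _ m) !ltnS !leqnSn /= (gtn_eqF (ltnSn _)) eqxx.
case: odd => hint; apply: (@frac_int_dvdn R); rewrite ?muln_gt0 ?c0 //.
(* For odd [m] the crossing has ordinate [1 - h], measured from the edge y = 1. *)
rewrite -/h (_ : h * n%:R = n%:R - (1 - h) * n%:R); last by ring.
by rewrite rpredB ?natr_int.
Qed.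

(** The corner crossing gives the factor [2 * d]; the zigzag supplies the missing [c], because
    [d - m * c] is coprime to [c]. *)
Lemma dvdn_common_many (R : realType) (q c d n : nat) :
  (0 < c)%N -> (c <= d)%N -> coprime c d -> (2 < q)%N -> (d <= q.-1 * c)%N ->
  common_denominator q (c%:R : R) d%:R n -> (2 * c * d %| n)%N.
Proof.
move=> c0 cd cop q2 dq hn.
have d0 : (0 < d)%N by apply: leq_trans cd.
have := @dvdn_common3 R q c d n c0 cd cop q2 hn.
have [c1 | c1] := leqP c 1.
  by have -> : c = 1%N by lia; rewrite muln1.
have cltd : (c < d)%N.
  rewrite ltn_neqAle cd andbT; apply: contraTneq cop => <-.
  by rewrite /coprime gcdnn; lia.
(* This is the ceiling of [d / c] minus 2: [m + 1] is the largest number of full crossings with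
   [(m + 1) * c < d], so the zigzag uses [m + 3 <= q] pieces. *)
pose m := (d.-1 %/ c).-1.
have Q1 : (0 < d.-1 %/ c)%N by rewrite divn_gt0 //; lia.
have Qle : (d.-1 %/ c * c <= d.-1)%N by apply: leq_trunc_div.
have Qlt : (d.-1 < (d.-1 %/ c).+1 * c)%N by apply: ltn_ceil.
have mQ : (d.-1 %/ c = m.+1)%N by rewrite prednK.
rewrite mQ in Qle Qlt.
have mcd : (m * c <= d <= (m + 2) * c)%N by nia.
have qm : (m + 2 < q)%N by nia.
have := @dvdn_common_zigzag R q c d m n c0 d0 mcd qm hn.
move=> h /dvdnP[k Ek]; rewrite Ek in h *.
have copm : coprime c (d - m * c).
  by rewrite /coprime -(gcdnMDl m) subnKC //; case/andP: mcd.
have : (c %| (d - m * c) * (d * k))%N.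
  by rewrite -(@dvdn_pmul2l 2) // mulnCA (mulnC d) (mulnCA 2).
rewrite (Gauss_dvdr _ copm) (Gauss_dvdr _ cop) => ck.
by rewrite (mulnC k) -!mulnA dvdn_pmul2l // (mulnC c) dvdn_pmul2l.
Qed.

(** * The four cases and the ceiling thresholds *)

Lemma least_denominator_values (R : realType) (q c d : nat) :
  (0 < c)%N -> (c <= d)%N -> coprime c d ->
  [/\ q = 1%N -> least_denominator q (c%:R : R) d%:R 1,
      q = 2%N -> least_denominator q (c%:R : R) d%:R d,
      (2 < q)%N -> (q.-1 * c < d)%N -> least_denominator q (c%:R : R) d%:R (2 * d) &
      (2 < q)%N -> (d <= q.-1 * c)%N ->
        least_denominator q (c%:R : R) d%:R (2 * c * d)].
Proof.
move=> c0 cd cop; have d0 : (0 < d)%N by apply: leq_trans cd.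
split=> [->|->|q2 qd|q2 qd].
- by split=> [|n _]; [exact: common_denominator1|exact: dvd1n].
- by split=> [|n]; [exact: common_denominator2|exact: dvdn_common2].
- by split=> [|n]; [exact: common_denominator_few|exact: dvdn_common3].
by split=> [|n]; [exact: common_denominator_all|exact: dvdn_common_many].
Qed.

Lemma ceil_frac_le (c d n : nat) :
  (0 < c)%N -> (Num.ceil (d%:R / c%:R : rat) <= n%:Z) = (d <= n * c)%N.
Proof.
by move=> c0; rewrite ceil_le_int -pmulrn ler_pdivrMr ?ltr0n // -natrM ler_nat.
Qed.

Theorem theorem6p12 (R : realType) (q : nat) (c d : int)
    (hc : c != 0) (hd : d != 0) (hcd : coprimez c d) :
  let moves := [:: (c, d); (c, - d)] in
  let chat := minn `|c|%N `|d|%N in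
  let dhat := maxn `|c|%N `|d|%N in
  let k : int := Num.ceil (dhat%:R / chat%:R : rat) in
  [/\ q = 1%N -> is_denominator R q moves 1,
      q = 2%N -> is_denominator R q moves dhat,
      (3 <= q)%N -> q%:Z <= k -> is_denominator R q moves (2 * dhat)%N
    & (3 <= q)%N -> k + 1 <= q%:Z ->
        is_denominator R q moves (2 * chat * dhat)%N].
Proof.
move=> moves chat dhat k.
have c0 : (0 < `|c|)%N by rewrite absz_gt0.
have d0 : (0 < `|d|)%N by rewrite absz_gt0.
have chat0 : (0 < chat)%N by rewrite leq_min c0 d0.
have dhat0 : (0 < dhat)%N by rewrite leq_max c0.
have le_cd : (chat <= dhat)%N by rewrite /chat /dhat; lia.
have cop : coprime chat dhat.
  rewrite /chat /dhat; move: hcd; rewrite coprimezE /minn /maxn.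
  by case: ifP; rewrite // coprime_sym.
(* If [|c|] exceeds [|d|], the diagonal reflection reduces to the ordered pair. *)
have least D : (0 < D)%N -> least_denominator q (chat%:R : R) dhat%:R D ->
    is_denominator R q moves D.
  move=> D0 h; apply: least_denominatorP => //.
  move: h; rewrite /chat /dhat; have [le|lt] := leqP `|c|%N `|d|%N => h.
    exact: h.
  exact: least_denominator_swap.
have [q1 q2 q3 q4] := @least_denominator_values R q chat dhat chat0 le_cd cop.
(* Applied with [n = q.-1], this turns both thresholds into comparisons of [dhat] with
   [q.-1 * chat]. *)
have kle n : (k <= n%:Z) = (dhat <= n * chat)%N by rewrite /k ceil_frac_le.
split=> [/q1|/q2|lt2q qk|lt2q kq].
- exact: least.
- exact: least.
- apply: least; first by rewrite muln_gt0.
  apply: q3 => //; rewrite ltnNge -kle; apply/negP => kq; lia.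
apply: least; first by rewrite !muln_gt0 chat0.
by apply: q4 => //; rewrite -kle; lia.
Qed.
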